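(* Let $n\ge1$ and let $\pi\in\mathcal{NC}(2n)$ be such that $\mathcal{G}_\pi$ is connected. Then $\mathcal{G}_\pi$ is a cactus graph.
   Context: $\mathcal{NC}(2n)$ is the set of non-crossing partitions of $\{1,\dots,2n\}$. For $\pi\in\mathcal{NC}(2n)$, the undirected graph $\mathcal{G}_\pi$ (loops and multiple edges allowed) has as vertices the blocks of $\pi$, and for each $k=1,\dots,n$ one edge joining the block containing $2k-1$ and the block containing $2k$. For a graph with loops and multiple edges allowed, a cycle is a finite sequence $(v_1,e_1,v_2,e_2,\dots,v_j,e_j)$ of vertices and edges such that $e_i$ connects $v_i$ with $v_{i+1}$ for $i=1,\dots,j$ (with $v_{j+1}=v_1$). A simple cycle is a cycle whose vertices $v_1,\dots,v_j$ are pairwise distinct and whose edges $e_1,\dots,e_j$ are pairwise distinct, considered up to cyclic rotation and reversal (a loop gives a simple cycle with $j=1$, a pair of parallel edges gives one with $j=2$). A cactus is a connected graph in which every edge belongs to at most one simple cycle. *)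

(* Defs.v *)
From mathcomp Require Import all_boot.

Set Implicit Arguments.
Unset Strict Implicit.
Unset Printing Implicit Defensive.

(* Finite undirected graphs with loops and multiple edges.  [src] and [tgt]
   list the two ends of an edge in an arbitrary order, which [joins] forgets. *)
Record multigraph := MGraph {
  vertex : finType;
  edge : finType;
  src : edge -> vertex;
  tgt : edge -> vertex
}.

Section Multigraph.
Variable G : multigraph.
Implicit Types (e : edge G) (u v : vertex G) (c : seq (vertex G * edge G)).

Definition joins e u v : bool :=
  ((src e == u) && (tgt e == v)) || ((src e == v) && (tgt e == u)).

Definition adjacent : rel (vertex G) := fun u v => [exists e, joins e u v].

Definition connected_graph : Prop := forall u v, connect adjacent u v.

(* The cycle (v_1, e_1, ..., v_j, e_j) is encoded as the sequence of pairs
   [:: (v_1, e_1); ...; (v_j, e_j)]; [path.cycle] also relates the last pair to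
   the first one, which is the convention v_{j+1} = v_1. *)
Definition is_cycle c : bool :=
  (c != [::]) && cycle (fun x y => joins x.2 x.1 y.1) c.

Definition simple_cycle c : bool :=
  [&& is_cycle c, uniq (unzip1 c) & uniq (unzip2 c)].

(* (v_1, e_1, ..., v_j, e_j) becomes (v_1, e_j, v_j, e_{j-1}, ..., v_2, e_1). *)
Definition reverse_cycle c : seq (vertex G * edge G) :=
  zip (rotr 1 (rev (unzip1 c))) (rev (unzip2 c)).

Definition same_cycle c c' : Prop :=
  exists k, c' = rot k c \/ c' = rot k (reverse_cycle c).

Definition cactus : Prop :=
  connected_graph /\
  forall e c c',
    simple_cycle c -> simple_cycle c' ->
    e \in unzip2 c -> e \in unzip2 c' -> same_cycle c c'.

End Multigraph.

(* Non-crossing partitions of {1, ..., m}; the element i of {1, ..., m} is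
   represented by i - 1 in 'I_m. *)
Record NC (m : nat) := MkNC {
  blocks :> {set {set 'I_m}};
  blocks_partition : partition blocks [set: 'I_m];
  blocks_noncrossing :
    forall (B C : {set 'I_m}) (a b c d : 'I_m),
      B \in blocks -> C \in blocks ->
      a < b -> b < c -> c < d ->
      a \in B -> c \in B -> b \in C -> d \in C -> B = C
}.

Definition block_type (m : nat) (p : NC m) : finType :=
  {B : {set 'I_m} | B \in blocks p}.

Lemma block_of_subproof (m : nat) (p : NC m) (i : 'I_m) :
  pblock p i \in blocks p.
Proof. by rewrite pblock_mem // (cover_partition (blocks_partition p)) inE. Qed.

Definition block_of (m : nat) (p : NC m) (i : 'I_m) : block_type p :=
  exist _ (pblock p i) (block_of_subproof p i).

Lemma left_end_subproof (n : nat) (k : 'I_n) : 2 * k < 2 * n.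
Proof. by rewrite ltn_pmul2l. Qed.

Lemma right_end_subproof (n : nat) (k : 'I_n) : (2 * k).+1 < 2 * n.
Proof. by rewrite -[(2 * k).+2](mulnDr 2 1 k) leq_pmul2l. Qed.

(* With 0-based indices the pair {2k - 1, 2k}, 1 <= k <= n, becomes
   {2k, 2k + 1}, 0 <= k < n. *)
Definition left_end (n : nat) (k : 'I_n) : 'I_(2 * n) :=
  Ordinal (left_end_subproof k).

Definition right_end (n : nat) (k : 'I_n) : 'I_(2 * n) :=
  Ordinal (right_end_subproof k).

Definition graph_of (n : nat) (p : NC (2 * n)) : multigraph :=
  @MGraph (block_type p) 'I_n
    (fun k => block_of p (left_end k)) (fun k => block_of p (right_end k)).

(* Main.v *)
Require Import Defs.
From mathcomp Require Import all_boot.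
From mathcomp Require Import zify.

(** Draw the points on a circle, the blocks as disjoint polygons inside it and
    the edges as every other arc of the circle.  All edges then border the
    outer face, which is why no two simple cycles can share one of them.

    The combinatorial form of this argument numbers points and edges from 0 and
    looks at two edges [k < l] and at the points [2k + 1, ..., 2l] lying between
    them.  Either some block has one point in this interval and another one
    outside, or no block has.
    - In the first case the chord between these two points separates [k] from
      [l]: by non-crossing, two edges on different sides of the chord can only
      meet at that block.  A simple cycle goes through the block at most once,
      so it cannot contain both [k] and [l] ([simple_cycle_cut_vertex]).
    - In the second case the blocks inside the interval form a set of vertices
      that only the edges [k] and [l] leave, so a simple cycle that contains
      one of them contains the other ([simple_cycle_edge_cut]).
    Hence if [k] and [l] lie on a common simple cycle, every simple cycle
    through [k] passes through [l] ([edges_on_common_cycle]).  Two simple cycles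
    with a common edge therefore have the same edges, and a simple cycle is
    determined, up to rotation and reversal, by its edges
    ([same_edges_same_cycle]). *)

Set Implicit Arguments.
Unset Strict Implicit.
Unset Printing Implicit Defensive.

(** * Simple cycles in a multigraph *)

Lemma uniq_map_inj (T1 T2 : eqType) (f : T1 -> T2) (s : seq T1) :
  uniq (map f s) -> {in s &, injective f}.
Proof.
elim: s => //= z s IH /andP[zs U] x y; rewrite !inE.
case/orP=> [/eqP->|xs] /orP[/eqP->|ys] // eqf; last exact: IH.
  by rewrite eqf map_f in zs.
by rewrite -eqf map_f in zs.
Qed.

Section SimpleCycles.
Variable G : multigraph.
Implicit Types (e f g h : edge G) (u v w : vertex G).
Implicit Types (x y z : vertex G * edge G) (c p : seq (vertex G * edge G)).

Definition incident e v : bool := (src e == v) || (tgt e == v).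

Definition step x y : bool := joins x.2 x.1 y.1.

Lemma joinsC e u v : joins e u v = joins e v u.
Proof. by rewrite /joins orbC. Qed.

Lemma joins_incident e u v : joins e u v -> incident e u.
Proof. by rewrite /incident => /orP[] /andP[h1 h2]; rewrite ?h1 ?h2 ?orbT. Qed.

Lemma joins_inj e u v w : joins e u v -> joins e u w -> v = w.
Proof.
by case/orP=> /andP[/eqP<- /eqP<-] /orP[] /andP[/eqP ? /eqP ?]; congruence.
Qed.

Lemma joins_ends e u v w : joins e u v -> incident e w -> w = u \/ w = v.
Proof.
by case/orP=> /andP[/eqP<- /eqP<-] /orP[] /eqP->; auto.
Qed.

Lemma simple_cycle_rot k c : simple_cycle (rot k c) = simple_cycle c.
Proof.
rewrite /simple_cycle /is_cycle rot_cycle /unzip1 /unzip2 !map_rot !rot_uniq.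
by rewrite -!size_eq0 size_rot.
Qed.

Lemma simple_cycle_cons x p :
  simple_cycle (x :: p) ->
  [/\ path step x (rcons p x), x.1 \notin unzip1 p & x.2 \notin unzip2 p].
Proof. by case/and3P=> /andP[_ pth] /= /andP[-> _] /andP[-> _]. Qed.

Lemma path_constant_edge (T : eqType) (side : edge G -> T) v x p x0 :
  (forall g h u, u != v -> incident g u -> incident h u -> side g = side h) ->
  path step x (rcons p x0) -> v \notin unzip1 p ->
  forall y, y \in x :: p -> side y.2 = side x.2.
Proof.
move=> sideP; elim: p x => [|z p IH] x /=.
  by move=> _ _ y /[!inE] /eqP->.
move=> /andP[xz pth] /[!inE] /norP[vz vp] y /orP[/eqP-> //|yp].
rewrite (IH z pth vp y yp); apply: (sideP _ _ z.1); first by rewrite eq_sym.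
  by case: p pth {IH vp yp} => [|t p] /andP[/joins_incident].
by apply: (@joins_incident _ _ x.1); rewrite joinsC.
Qed.

(** Rotate the cycle to start at [v], or anywhere if it avoids [v]: the
    vertices that follow are then distinct from [v], and [side] cannot change
    from one edge to the next. *)
Lemma simple_cycle_cut_vertex (T : eqType) (side : edge G -> T) v c :
  (forall g h u, u != v -> incident g u -> incident h u -> side g = side h) ->
  simple_cycle c -> {in unzip2 c &, forall e f, side e = side f}.
Proof.
move=> sideP sc.
have [k [x [p [defc vp]]]] :
    exists k x p, rot k c = x :: p /\ v \notin unzip1 p.
  have [/mapP[x xc ->]|vc] := boolP (v \in unzip1 c).
    have [k p defc] := rot_to xc; exists k, x, p; split=> //.
    by move: sc; rewrite -(simple_cycle_rot k) defc => /simple_cycle_cons[].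
  case: c sc vc => [|x p] //= _ /norP[_ vp].
  by exists 0, x, p; rewrite rot0.
have [pth _ _] : [/\ path step x (rcons p x), x.1 \notin unzip1 p
                   & x.2 \notin unzip2 p].
  by apply: simple_cycle_cons; rewrite -defc simple_cycle_rot.
have cst e : e \in unzip2 c -> side e = side x.2.
  case/mapP=> y yc ->; apply: (path_constant_edge sideP pth vp).
  by rewrite -defc mem_rot.
by move=> e f /cst-> /cst->.
Qed.

Lemma path_constant_vertex (S : pred (vertex G)) (A : pred (edge G)) x p x0 :
  (forall g, A g -> S (src g) = S (tgt g)) ->
  path step x (rcons p x0) -> all A (unzip2 (x :: p)) -> S x.1 = S x0.1.
Proof.
move=> SP; have SJ e u v : A e -> joins e u v -> S u = S v.
  by move=> /SP eqS /orP[] /andP[/eqP<- /eqP<-].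
elim: p x => [|y p IH] x /= /andP[xy pth] /andP[Ax Ap].
  exact: SJ Ax xy.
by rewrite (SJ _ _ _ Ax xy); apply: IH.
Qed.

(** A closed walk cannot cross the boundary of [S] exactly once. *)
Lemma simple_cycle_edge_cut (S : pred (vertex G)) e f c :
  (forall g, g != e -> g != f -> S (src g) = S (tgt g)) ->
  S (src e) != S (tgt e) ->
  simple_cycle c -> e \in unzip2 c -> f \in unzip2 c.
Proof.
move=> SP Se sc /mapP[[v e'] xc /= def_e]; subst e'.
apply: contraT => fc.
have [k p defc] := rot_to xc.
have [pth _ ep] : [/\ path step (v, e) (rcons p (v, e)), v \notin unzip1 p
                   & e \notin unzip2 p].
  by apply: (@simple_cycle_cons (v, e)); rewrite -defc simple_cycle_rot.
have fp : f \notin unzip2 p.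
  have := mem_rot k (unzip2 c) f; rewrite (negPf fc) /unzip2 -map_rot defc /=.
  by rewrite inE => /norP[].
have Ap : all [pred g | (g != e) && (g != f)] (unzip2 p).
  apply/allP => g gp /=.
  by apply/andP; split; [move: ep | move: fp]; apply: contraNneq => <-.
have SP' g : (g != e) && (g != f) -> S (src g) = S (tgt g).
  by case/andP; apply: SP.
have Sj u : joins e v u -> S u != S v.
  by case/orP=> /andP[/eqP<- /eqP<-] //; rewrite eq_sym.
case: p pth Ap {ep fp defc} => [|y p] /= /andP[/Sj Svy pth].
  by rewrite eqxx in Svy.
by move/(path_constant_vertex SP' pth)=> eqS; rewrite eqS eqxx in Svy.
Qed.

(** * A simple cycle is determined by its edges *)

Lemma reverse_cycleE x p :
  reverse_cycle (x :: p) = rev (zip (rcons (unzip1 p) x.1) (unzip2 (x :: p))).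
Proof.
by rewrite rev_zip ?size_rcons ?size_map //= /reverse_cycle -rev_rot rot1_cons.
Qed.

Lemma reverse_path x p x0 a :
  path step x (rcons p x0) ->
  path (fun y z => step z y) (x.1, a)
       (zip (rcons (unzip1 p) x0.1) (unzip2 (x :: p))).
Proof.
elim: p x a => [|y p IH] x a /= /andP[xy pth];
  rewrite /step /= joinsC (xy : joins _ _ _) //=.
exact: IH pth.
Qed.

Lemma last_zip_rcons v (s : seq (vertex G)) (t : seq (edge G)) x :
  size t = (size s).+1 -> (last x (zip (rcons s v) t)).1 = v.
Proof.
elim: s t x => [|u s IH] [|e t] x //= [szt]; last exact: IH.
by case: t szt.
Qed.

Lemma unzip2_reverse c : unzip2 (reverse_cycle c) = rev (unzip2 c).
Proof. by rewrite unzip2_zip // size_rotr !size_rev !size_map. Qed.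

Lemma reverse_simple c : simple_cycle c -> simple_cycle (reverse_cycle c).
Proof.
case: c => // x p sc; have [pth _ _] := simple_cycle_cons sc.
case/and3P: sc => _ U1 U2; rewrite /simple_cycle unzip2_reverse rev_uniq U2.
rewrite unzip1_zip ?size_rotr ?size_rev ?size_map // rotr_uniq rev_uniq U1.
rewrite !andbT.
apply/andP; split.
  by rewrite -size_eq0 size_zip size_rotr !size_rev !size_map minnn.
rewrite reverse_cycleE rev_cycle (cycle_path x).
set s := zip _ _; have := reverse_path (last x s).2 pth; rewrite -/s.
have <- : (last x s).1 = x.1 by apply: last_zip_rcons; rewrite /= !size_map.
by rewrite -surjective_pairing.
Qed.

Lemma step_next c x : simple_cycle c -> x \in c -> step x (next c x).
Proof. by case/and3P=> /andP[_ cyc] _ _; apply: next_cycle. Qed.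

Lemma simple_cycle_uniq c : simple_cycle c -> uniq c.
Proof. by case/and3P=> _ /map_uniq. Qed.

Lemma unzip1_inj c : simple_cycle c -> {in c &, injective fst}.
Proof. by case/and3P=> _ U _; apply: uniq_map_inj. Qed.

Lemma unzip2_inj c : simple_cycle c -> {in c &, injective snd}.
Proof. by case/and3P=> _ _ U; apply: uniq_map_inj. Qed.

(** The only edges of a simple cycle incident to the vertex that follows [x] are
    that of [x] itself and that of its successor, so both cycles must continue
    with the latter. *)
Lemma next_same_edges c c' x :
  simple_cycle c -> simple_cycle c' -> unzip2 c =i unzip2 c' ->
  x \in c -> x \in c' -> next c x = next c' x.
Proof.
move=> sc sc' eqE xc xc'.
set y := next c x; set y' := next c' x.
have yc : y \in c by rewrite mem_next.
have yc' : y' \in c' by rewrite mem_next.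
have eq1 : y.1 = y'.1 by exact: joins_inj (step_next sc xc) (step_next sc' xc').
have /mapP[z zc eqz] : y'.2 \in unzip2 c by rewrite eqE; apply/mapP; exists y'.
have: incident z.2 y.1.
  by rewrite -eqz eq1; exact: joins_incident (step_next sc' yc').
case/(joins_ends (step_next sc zc)) => [eqyz|eqyz].
  have eqy : y = z by apply: (unzip1_inj sc).
  by rewrite [y]surjective_pairing [y']surjective_pairing eq1 eqz eqy.
(* The edge of [y'] is then that of [x]: both cycles consist of one loop. *)
have eqyn : y = next c z by apply: (unzip1_inj sc); rewrite ?mem_next.
have eqxz : x = z.
  by apply: (can_inj (prev_next (simple_cycle_uniq sc))).
have eqy' : y' = x by apply: (unzip2_inj sc'); rewrite // eqz eqxz.
by rewrite eqy'; apply: (unzip1_inj sc); rewrite // eq1 eqy'.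
Qed.

Lemma simple_cycle_traject x p :
  simple_cycle (x :: p) ->
  x :: p = traject (next (x :: p)) x (size p).+1.
Proof.
move=> sc; have := cycle_next (simple_cycle_uniq sc).
rewrite /cycle => /fpathP[m eqp]; have := congr1 size eqp.
rewrite size_rcons size_traject => szp; rewrite trajectS.
move: eqp; rewrite -szp trajectSr => /rcons_inj[eqp _].
by rewrite -eqp.
Qed.

(** Both cycles, rotated to start at [x], list the iterates of their successor
    functions, which agree wherever both are defined. *)
Lemma same_edges_rot c c' x :
  simple_cycle c -> simple_cycle c' -> unzip2 c =i unzip2 c' ->
  x \in c -> x \in c' -> exists k, c' = rot k c.
Proof.
move=> sc sc' eqE xc xc'.
have [i p defc] := rot_to xc; have [j p' defc'] := rot_to xc'.
suff eqr : rot i c = rot j c'.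
  by eexists; rewrite -(rotK j c') -eqr /rotr rot_rot_add.
have sp : simple_cycle (x :: p) by rewrite -defc simple_cycle_rot.
have sp' : simple_cycle (x :: p') by rewrite -defc' simple_cycle_rot.
have eqEp : unzip2 (x :: p) =i unzip2 (x :: p').
  by move=> e; rewrite -defc -defc' /unzip2 !map_rot !mem_rot.
have eqsz : size p = size p'.
  have /perm_size := uniq_perm (andP (andP sp).2).2 (andP (andP sp').2).2 eqEp.
  by rewrite !size_map => -[].
rewrite defc defc' (simple_cycle_traject sp) (simple_cycle_traject sp') eqsz.
have iterE m : iter m (next (x :: p)) x = iter m (next (x :: p')) x
               /\ iter m (next (x :: p)) x \in x :: p.
  elim: m => [|m [IH mp]]; first by rewrite !inE eqxx.
  split; last by rewrite iterS mem_next.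
  rewrite !iterS -IH; apply: next_same_edges => //.
  rewrite IH; elim: m {IH mp} => [|m IH]; first by rewrite inE eqxx.
  by rewrite iterS mem_next.
apply: (@eq_from_nth _ x); rewrite ?size_traject // => m lt_m.
by rewrite !nth_traject //; case: (iterE m).
Qed.

(** If a common edge is traversed in opposite directions, reversing one of the
    cycles makes the directions agree. *)
Lemma same_edges_same_cycle c c' :
  simple_cycle c -> simple_cycle c' -> unzip2 c =i unzip2 c' ->
  same_cycle c c'.
Proof.
move=> sc sc' eqE.
case: c sc eqE => // x p sc eqE; set c := x :: p.
have xc : x \in c by rewrite inE eqxx.
have /mapP[y yc' eqe] : x.2 \in unzip2 c' by rewrite -eqE inE eqxx.
have: incident x.2 y.1 by rewrite eqe (joins_incident (step_next sc' yc')).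
case/(joins_ends (step_next sc xc)) => eqv.
  have eqy : y = x.
    by rewrite [y]surjective_pairing eqv -eqe -surjective_pairing.
  have xc' : x \in c' by rewrite -eqy.
  have [k ->] := same_edges_rot sc sc' eqE xc xc'.
  by exists k; left.
have eqE' : unzip2 (reverse_cycle c) =i unzip2 c'.
  by move=> e; rewrite unzip2_reverse mem_rev eqE.
have yr : y \in reverse_cycle c.
  rewrite [y]surjective_pairing eqv -eqe reverse_cycleE mem_rev.
  by case: (p) => [|z q] /=; rewrite eqxx inE eqxx.
have [k ->] := same_edges_rot (reverse_simple sc) sc' eqE' yr yc'.
by exists k; right.
Qed.

End SimpleCycles.

(** * Non-crossing partitions *)

Section NonCrossing.
Variables (n : nat) (p : NC (2 * n)).
Implicit Types (k l g h : 'I_n) (a b i j : 'I_(2 * n)).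

Lemma block_of_noncrossing a b i j :
  a < b -> b < i -> i < j ->
  block_of p a = block_of p i -> block_of p b = block_of p j ->
  block_of p a = block_of p b.
Proof.
move=> ab bi ij eqai eqbj; apply: val_inj => /=.
have memb q : q \in pblock p q.
  by rewrite mem_pblock (cover_partition (blocks_partition p)) inE.
apply: (blocks_noncrossing (block_of_subproof p a) (block_of_subproof p b)
          ab bi ij) => //.
  by have /= -> := congr1 val eqai.
by have /= -> := congr1 val eqbj.
Qed.

Lemma incident_graph_of g (v : vertex (graph_of p)) :
  @incident (graph_of p) g v ->
  exists2 a : 'I_(2 * n), block_of p a = v &
    (a = 2 * g :> nat) \/ (a = (2 * g).+1 :> nat).
Proof.
by case/orP=> /eqP<-; [exists (left_end g) | exists (right_end g)]; auto.
Qed.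

(** The chord [a, b] of a block separates the remaining blocks: the edges drawn
    between [a] and [b] meet the other edges only at that block. *)
Lemma chord_separates a b :
  a < b -> block_of p a = block_of p b ->
  forall g h (v : vertex (graph_of p)), v != block_of p a ->
  @incident (graph_of p) g v -> @incident (graph_of p) h v ->
  (a <= 2 * g < b) = (a <= 2 * h < b).
Proof.
move=> ab eqab g h v vB.
have inside q : block_of p q = v -> (q != a :> nat) && (q != b :> nat).
  move=> eqq; apply/andP; split; apply: contraNneq vB => /val_inj eqv.
    by rewrite -eqq eqv.
  by rewrite -eqq eqv eqab.
have arc q q' :
    block_of p q = v -> block_of p q' = v -> a < q < b -> a < q' < b.
  move=> eqq eqq' /andP[aq qb]; have /andP[q'a q'b] := inside _ eqq'.
  have [//|[lt_q'a|lt_bq']] : a < q' < b \/ q' < a \/ b < q' by lia.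
  - case/eqP: vB; rewrite -eqq'.
    by apply: block_of_noncrossing lt_q'a aq qb _ eqab; rewrite eqq eqq'.
  - case/eqP: vB; rewrite -eqq; apply/esym.
    by apply: block_of_noncrossing aq qb lt_bq' eqab _; rewrite eqq eqq'.
case/incident_graph_of=> q eqq eg /incident_graph_of[q' eqq' eh].
have := inside _ eqq; have := inside _ eqq'.
have := arc _ _ eqq eqq'; have := arc _ _ eqq' eqq.
by lia.
Qed.

(** The dichotomy between a block that straddles the points from [2 * k + 1] to
    [2 * l] and an interval that is a union of blocks. *)
Lemma edges_on_common_cycle_lt k l
    (c c' : seq (vertex (graph_of p) * edge (graph_of p))) :
  k < l -> simple_cycle c -> simple_cycle c' ->
  k \in unzip2 c -> l \in unzip2 c ->
  (k \in unzip2 c') = (l \in unzip2 c').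
Proof.
move=> kl sc sc' kc lc.
pose I (i : nat) := 2 * k < i <= 2 * l.
have [/forallP saturated|] :=
  boolP [forall i, forall j, (block_of p i == block_of p j) ==> (I i == I j)].
  pose S (v : vertex (graph_of p)) := [exists i, (block_of p i == v) && I i].
  have SE i : S (block_of p i) = I i.
    apply/existsP/idP => [[j /andP[eqv Ij]]|Ii]; last by exists i; rewrite eqxx.
    by have /forallP/(_ i)/implyP/(_ eqv)/eqP <- := saturated j.
  have cut g : g != k -> g != l ->
      S (@src (graph_of p) g) = S (@tgt (graph_of p) g).
    rewrite -!val_eqE /= => gk gl; rewrite !SE /I /=; lia.
  have crossk : S (@src (graph_of p) k) != S (@tgt (graph_of p) k).
    rewrite /= !SE /I /=; lia.
  have crossl : S (@src (graph_of p) l) != S (@tgt (graph_of p) l).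
    rewrite /= !SE /I /=; lia.
  apply/idP/idP; first exact:
    (@simple_cycle_edge_cut (graph_of p) S k l c' cut crossk sc').
  have cut' g : g != l -> g != k ->
      S (@src (graph_of p) g) = S (@tgt (graph_of p) g).
    by move=> gl gk; apply: cut.
  exact: (@simple_cycle_edge_cut (graph_of p) S l k c' cut' crossl sc').
rewrite negb_forall => /existsP[i]; rewrite negb_forall => /existsP[j].
rewrite negb_imply => /andP[/eqP eqij neI].
wlog lt_ij : i j eqij neI / i < j.
  move=> wl; case: (ltngtP i j) => [|ji|/val_inj ij]; first exact: wl.
    by apply: wl ji; rewrite // eq_sym.
  by rewrite ij eqxx in neI.
pose side (g : 'I_n) := i <= 2 * g < j.
have : side k = side l.
  apply: (@simple_cycle_cut_vertex (graph_of p) _ side (block_of p i) c) => //.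
  exact: chord_separates.
(* Exactly one of [i] and [j] lies between the edges [k] and [l], so exactly
   one of these edges lies between [i] and [j]. *)
by move: neI; rewrite /side /I; lia.
Qed.

Lemma edges_on_common_cycle k l
    (c c' : seq (vertex (graph_of p) * edge (graph_of p))) :
  simple_cycle c -> simple_cycle c' ->
  k \in unzip2 c -> l \in unzip2 c -> k \in unzip2 c' -> l \in unzip2 c'.
Proof.
move=> sc sc' kc lc; case: (ltngtP k l) => [kl|lk|/val_inj-> //].
  by rewrite (edges_on_common_cycle_lt kl sc sc' kc lc).
by rewrite (edges_on_common_cycle_lt lk sc sc' lc kc).
Qed.

End NonCrossing.

Theorem proposition1p10 (n : nat) (hn : 1 <= n) (p : NC (2 * n))
    (hconn : connected_graph (graph_of p)) :
  cactus (graph_of p).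
Proof.
split=> // e c c' sc sc' ec ec'; apply: same_edges_same_cycle => // f.
apply/idP/idP => fc.
  exact: (edges_on_common_cycle sc sc' ec fc ec').
exact: (edges_on_common_cycle sc' sc ec' fc ec).
Qed.
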